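(* There exists an infinite sequence $(Z_j)_{j\ge 1}$ of pairwise distinct finite non-empty sets of points in the real projective plane $\mathbb{P}^2(\mathbb{R})$ such that, for every $j\ge 1$, the homogeneous ideal $I_j=I(Z_j)\subset\mathbb{R}[x,y,z]$ of all polynomials vanishing at every point of $Z_j$ satisfies $$I_j^{(3)}\not\subset I_j^{2}.$$
   Context: For a finite set of points $Z\subset\mathbb{P}^2(\mathbb{R})$, $I(Z)\subset\mathbb{R}[x,y,z]$ denotes the ideal generated by all homogeneous polynomials vanishing at every point of $Z$. For an ideal $I=I(Z)$ of this kind, $I^r$ denotes its ordinary (algebraic) $r$-th power as an ideal. The $m$-th symbolic power $I^{(m)}$ is the homogeneous ideal generated by all homogeneous polynomials vanishing to order at least $m$ at every point of $Z$; equivalently, $I^{(m)}=\bigcap_{P\in Z} I(\{P\})^m$. A counterexample to the containment $I^{(3)}\subset I^2$ defined in the real plane is a finite set $Z$ of points in $\mathbb{P}^2(\mathbb{R})$ whose ideal $I=I(Z)$ does not satisfy this containment. *)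

(* Defs.v *)
From HB Require Import structures.
From mathcomp Require Import all_boot all_order all_algebra.
From mathcomp Require Import finmap classical_sets reals.
From mathcomp Require Import mpoly.

Set Implicit Arguments.
Unset Strict Implicit.
Unset Printing Implicit Defensive.

Import GRing.Theory.
Local Open Scope classical_set_scope.
Local Open Scope ring_scope.

Definition is_ideal (A : comNzRingType) (J : set A) : Prop :=
  [/\ J 0,
      forall f g, J f -> J g -> J (f + g)
    & forall a f, J f -> J (a * f)].

Definition ideal_gen (A : comNzRingType) (S : set A) : set A :=
  smallest (@is_ideal A) S.

Definition ideal_pow (A : comNzRingType) (J : set A) (r : nat) : set A :=
  ideal_gen [set g | exists2 f : 'I_r -> A,
                       (forall i, J (f i)) & g = \prod_(i < r) f i].

(* A point of the projective plane is a line through the origin of K^3. *)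
Definition proj_plane (K : numFieldType) : choiceType :=
  {U : {vspace 'rV[K]_3} | \dim U == 1%N}.

(* Homogeneous coordinates of P. *)
Definition hcoord (K : numFieldType) (P : proj_plane K) (v : 'rV[K]_3) : Prop :=
  v != 0 /\ v \in val P.

Definition homogeneous (K : numFieldType) (f : {mpoly K[3]}) : Prop :=
  exists d : nat, f \is d.-homog.

Definition vanishes_at (K : numFieldType) (f : {mpoly K[3]}) (P : proj_plane K) :
    Prop :=
  forall v, hcoord P v -> f.@[v ord0] = 0.

(* Vanishing to order at least m is expressed by the partial derivatives of
   order < m; for homogeneous f this is the multiplicity at P, K being of
   characteristic 0. *)
Definition vanishes_to_order (K : numFieldType) (m : nat) (f : {mpoly K[3]})
    (P : proj_plane K) : Prop :=
  forall k : 'X_{1..3}, (mdeg k < m)%N -> vanishes_at (f^`M[k]) P.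

Definition point_ideal (K : numFieldType) (Z : {fset proj_plane K}) :
    set {mpoly K[3]} :=
  ideal_gen [set f | homogeneous f /\
                     forall P, P \in Z -> vanishes_at f P].

Definition symbolic_pow (K : numFieldType) (Z : {fset proj_plane K}) (m : nat) :
    set {mpoly K[3]} :=
  ideal_gen [set f | homogeneous f /\
                     forall P, P \in Z -> vanishes_to_order m f P].

(* Main.v *)
Require Import Defs.
From HB Require Import structures.
From Stdlib Require Import BinInt.
From mathcomp Require Import all_boot all_order all_algebra.
From mathcomp Require Import finmap classical_sets reals.
From mathcomp Require Import mpoly.
From mathcomp Require Import ssrZ zify ring.

Set Implicit Arguments.
Unset Strict Implicit.
Unset Printing Implicit Defensive.

Local Open Scope classical_set_scope.
Local Open Scope ring_scope.

Import Order.TTheory GRing.Theory Num.Theory.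

(** Twelve lines of the plane, meeting three by three in 19 points, give a
counterexample: if F is the product of the lines and I the ideal of the 19
points, F vanishes to order 3 at every point, but F is not in I^2.

To see that F is not in I^2, one exhibits a linear form L on the polynomials of
degree 12 that kills I^2 and takes a nonzero value on F.  Conditions at the
points alone do not suffice for this, since F satisfies all the local
conditions that define I^(2); L comes from the defect I^(2) / I^2, which is of
dimension 1 in degree 12.  The reason why L kills I^2 is the structure of I in
low degree: no quartic passes through the 19 points, the quintics through them
are the combinations of three quintics q_1, q_2, q_3, and the sextics through
them are the combinations of the products of these with a linear form.  For two
homogeneous elements of I whose degrees have sum 12, one has degree at most 6,
so their product is a combination of products q_i * h with h a form of degree 7
in I ([obstruction_homog_mul]).  But L (q_i * h) is, as a function of h, a
combination of the values of h at the 19 points ([weights_certificate]), so it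
is 0 as soon as h is in I.

Each assertion of linear algebra involved here has the form of an identity
between linear maps on the forms of a given degree, and is checked on the
monomials of this degree, by computation with integer coefficients.  For the
description of the forms f of degree d in I, the identity is
  D f = sum_k l_k (f) b_k + sum_P f (P) s_P
with fixed forms b_k (the generators), s_P and linear forms l_k
([interpolation]): if f vanishes at the points P, it is a combination of the
b_k.

The infinite family is the orbit of this configuration under the shears
(x : y : z) -> (x + t z : y : z), t = 0, 1, 2, ...  A shear acts on
polynomials by a ring automorphism, so the argument applies to every member of
the family.  The members are distinct because the configuration contains
(0 : 0 : 1) but no point (n : 0 : 1) with n > 0. *)

(** * Polynomials with integer coefficients, as data for computation *)

Delimit Scope Z_scope with BZ.

Definition expo := (nat * nat * nat)%type.
Definition zpoly := seq (Z * expo).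

(** The order of this enumeration is the one in which the coefficients of a
form are listed below: 1; x, y, z; x^2, xy, xz, y^2, yz, z^2; and so on. *)
Definition mons (d : nat) : seq expo :=
  [seq (d - s, s - k, k)%N | s <- iota 0 d.+1, k <- iota 0 s.+1].

Definition addx (m n : expo) : expo :=
  (m.1.1 + n.1.1, m.1.2 + n.1.2, m.2 + n.2)%N.

Definition eqx (m n : expo) : bool :=
  [&& eqn m.2 n.2, eqn m.1.2 n.1.2 & eqn m.1.1 n.1.1].

Definition zsum : seq Z -> Z := foldr Z.add 0%BZ.

(** Zero coefficients are dropped because the products computed below are
expanded without collecting terms. *)
Definition form (d : nat) (r : seq Z) : zpoly :=
  [seq a <- zip r (mons d) | ~~ Z.eqb a.1 0].

Definition zmul (p q : zpoly) : zpoly :=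
  [seq (Z.mul a.1 b.1, addx a.2 b.2) | a <- p, b <- q].

Definition zscale (c : Z) (p : zpoly) : zpoly :=
  [seq (Z.mul c a.1, a.2) | a <- p].

Definition zcoef (p : zpoly) (m : expo) : Z :=
  zsum [seq if eqx a.2 m then a.1 else 0%BZ | a <- p].

Definition znull (d : nat) (p : zpoly) : bool :=
  all (fun a => eqn (a.2.1.1 + a.2.1.2 + a.2.2)%N d) p &&
  all (fun m => Z.eqb (zcoef p m) 0) (mons d).

Definition zcoef_form (t p : zpoly) : Z :=
  zsum [seq Z.mul a.1 (zcoef t a.2) | a <- p].

Definition zpow (z : Z) (n : nat) : Z := iter n (Z.mul z) 1%BZ.
Definition zmon (v : seq Z) (m : expo) : Z :=
  Z.mul (zpow v`_0 m.1.1) (Z.mul (zpow v`_1 m.1.2) (zpow v`_2 m.2)).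

(** For each monomial of degree d, the polynomial formed here is the difference
of the two sides of the identity in [interpolation]. *)
Definition interpolation_certificate (pts : seq (seq Z)) (d : nat) (D : Z)
    (ls bs ss : seq zpoly) : bool :=
  all (fun m =>
    znull d ((D, m)
      :: flatten [seq zscale (Z.opp (zcoef lb.1 m)) lb.2 | lb <- zip ls bs]
      ++ flatten [seq zscale (Z.opp (zmon vs.1 m)) vs.2 | vs <- zip pts ss]))
   (mons d).

Definition evaluation_certificate (pts : seq (seq Z)) (t : zpoly) (d : nat)
    (q : zpoly) (ws : seq Z) : bool :=
  all (fun m => Z.eqb (zcoef_form t (zmul q [:: (1%BZ, m)]))
        (zsum [seq Z.mul vw.2 (zmon vw.1 m) | vw <- zip pts ws])) (mons d).

Definition mon (m : expo) : 'X_{1..3} := [multinom [tuple m.1.1; m.1.2; m.2]].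

Lemma mem_zip (S T : eqType) (s : seq S) (r : seq T) x y :
  (x, y) \in zip s r -> (x \in s) && (y \in r).
Proof.
elim: s r => [|x' s IH] [|y' r] //=; rewrite !inE => /orP[/eqP[-> ->]|/IH].
  by rewrite !eqxx.
by case/andP=> -> ->; rewrite !orbT.
Qed.

Lemma mon_addx m n : mon (addx m n) = (mon m + mon n)%MM.
Proof.
apply/mnmP => i; rewrite mnmDE.
by case: i => [[|[|[|//]]] p].
Qed.

Lemma mdeg_mon m : mdeg (mon m) = (m.1.1 + m.1.2 + m.2)%N.
Proof. by rewrite mdegE !big_ord_recl big_ord0 addn0 addnA. Qed.

Lemma mdeg_mons d m : m \in mons d -> mdeg (mon m) = d.
Proof.
case/allpairsPdep=> [s [k]]; rewrite !mem_iota /= !add0n !ltnS => -[les lek ->].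
by rewrite mdeg_mon /= -addnA (subnK lek) (subnK les).
Qed.

Lemma eqxE m n : eqx m n = (mon m == mon n).
Proof.
apply/idP/eqP => [/and3P[/eqnP e2 /eqnP e1 /eqnP e0]|e].
  by apply/mnmP => -[[|[|[|//]]] p].
have coord i : mon m i = mon n i by rewrite e.
by apply/and3P; split; apply/eqnP;
  [exact: (coord 2%:R) | exact: (coord 1%:R) | exact: (coord 0)].
Qed.

Lemma mem_mons d (n : 'X_{1..3}) : mdeg n = d ->
  exists2 m, m \in mons d & n = mon m.
Proof.
rewrite mdegE !big_ord_recl big_ord0 addn0 => dE.
set i0 := ord0 in dE; set i1 := lift _ _ in dE; set i2 := lift _ _ in dE.
exists (n i0, n i1, n i2); last first.
  by apply/mnmP => -[[|[|[|//]]] p] /=; congr (n _); apply: val_inj.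
apply/allpairsPdep; exists (n i1 + n i2)%N, (n i2).
rewrite !mem_iota /= !add0n !ltnS -dE leq_addl leq_addl; split=> //.
by rewrite !addnK.
Qed.

(** * Linear identities between forms, checked on monomials *)

Section Construction.
Context (K : numFieldType).
Implicit Types (f g : {mpoly K[3]}) (p q t : zpoly) (P : seq Z) (v : 'rV[K]_3).

Definition zr (z : Z) : K := (int_of_Z z)%:~R.

Lemma zrD a b : zr (Z.add a b) = zr a + zr b.
Proof. by rewrite /zr -intrD -(rmorphD int_of_Z). Qed.

Lemma zrM a b : zr (Z.mul a b) = zr a * zr b.
Proof. by rewrite /zr -intrM -(rmorphM int_of_Z). Qed.

Lemma zrN a : zr (Z.opp a) = - zr a.
Proof. by rewrite /zr -mulrNz -(rmorphN int_of_Z). Qed.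

Lemma zr0 : zr 0 = 0. Proof. by []. Qed.
Lemma zr1 : zr 1 = 1. Proof. by []. Qed.

Lemma zr_eq0 a : (zr a == 0) = (Z.eqb a 0).
Proof.
rewrite /zr intr_eq0; apply/eqP/Z.eqb_spec => [e|-> //].
by rewrite -[a]int_of_ZK e.
Qed.

Lemma zr_zsum s : zr (zsum s) = \sum_(z <- s) zr z.
Proof. by elim: s => [|z s IH]; rewrite ?big_nil // big_cons /= zrD IH. Qed.

Lemma zr_zpow z n : zr (zpow z n) = zr z ^+ n.
Proof. by elim: n => [|n IH] //; rewrite exprS /= zrM IH. Qed.

Definition poly_of p : {mpoly K[3]} := \sum_(a <- p) zr a.1 *: 'X_[mon a.2].

Lemma poly_of_cons a p : poly_of (a :: p) = zr a.1 *: 'X_[mon a.2] + poly_of p.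
Proof. by rewrite /poly_of big_cons. Qed.

Lemma poly_of_cat p q : poly_of (p ++ q) = poly_of p + poly_of q.
Proof. by rewrite /poly_of big_cat. Qed.

Lemma poly_of_flatten (ps : seq zpoly) :
  poly_of (flatten ps) = \sum_(p <- ps) poly_of p.
Proof.
elim: ps => [|p ps IH]; first by rewrite /poly_of !big_nil.
by rewrite big_cons /= poly_of_cat IH.
Qed.

Lemma poly_of_mon m : poly_of [:: (1%BZ, m)] = 'X_[mon m].
Proof. by rewrite /poly_of big_seq1 scale1r. Qed.

Lemma poly_of_scale c p : poly_of (zscale c p) = zr c *: poly_of p.
Proof.
rewrite /poly_of big_map scaler_sumr; apply: eq_bigr => a _.
by rewrite /= zrM scalerA.
Qed.

Lemma poly_of_mul p q : poly_of (zmul p q) = poly_of p * poly_of q.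
Proof.
rewrite /poly_of big_allpairs_dep mulr_suml; apply: eq_bigr => a _.
rewrite mulr_sumr; apply: eq_bigr => b _ /=.
by rewrite mon_addx mpolyXD zrM -scalerAl -scalerAr scalerA.
Qed.

Lemma mcoeff_poly_of p m : (poly_of p)@_(mon m) = zr (zcoef p m).
Proof.
rewrite /poly_of raddf_sum /zcoef zr_zsum big_map; apply: eq_bigr => a _.
rewrite /= mcoeffZ mcoeffX eqxE; case: eqP => _; by rewrite ?mulr1 ?mulr0.
Qed.

Lemma znull_poly_of d p : znull d p -> poly_of p = 0.
Proof.
case/andP=> /allP degp /allP coefp; apply/mpolyP => n; rewrite mcoeff0.
have [/mem_mons[m m_in ->]|neq] := eqVneq (mdeg n) d.
  by apply/eqP; rewrite mcoeff_poly_of zr_eq0 coefp.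
rewrite /poly_of raddf_sum big_seq big1 //= => a /degp/eqnP degm.
rewrite mcoeffZ mcoeffX; case: eqP => [e|]; last by rewrite mulr0.
by rewrite -e mdeg_mon degm eqxx in neq.
Qed.

(** An integer polynomial t also stands for a linear form on polynomials, its
coefficients being the values on monomials. *)
Definition coef_form t f : K := \sum_(a <- t) zr a.1 * f@_(mon a.2).

Fact coef_form_is_linear t : linear_for *%R (coef_form t).
Proof.
move=> c f g; rewrite /coef_form mulr_sumr -big_split; apply: eq_bigr => a _.
by rewrite /= mcoeffD mcoeffZ mulrDr mulrCA.
Qed.

HB.instance Definition _ t :=
  GRing.isLinear.Build K {mpoly K[3]} K *%R (coef_form t)
    (coef_form_is_linear t).

Lemma coef_form_mon t m : coef_form t 'X_[mon m] = zr (zcoef t m).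
Proof.
rewrite /coef_form /zcoef zr_zsum big_map; apply: eq_bigr => b _ /=.
by rewrite mcoeffX eqxE eq_sym; case: eqP => _; rewrite ?mulr1 ?mulr0.
Qed.

Lemma coef_form_poly_of t p : coef_form t (poly_of p) = zr (zcoef_form t p).
Proof.
rewrite /poly_of /zcoef_form zr_zsum big_map raddf_sum; apply: eq_bigr => a _.
by rewrite /= linearZ /= coef_form_mon zrM.
Qed.

Definition vec P : 'rV[K]_3 := \row_(i < 3) zr P`_i.

Lemma meval_mon P m : 'X_[mon m].@[vec P ord0] = zr (zmon P m).
Proof.
rewrite mevalX !big_ord_recl big_ord0 mulr1 !mxE /=.
by rewrite /zmon !zrM !zr_zpow.
Qed.

Lemma homog_ind d (Q : {mpoly K[3]} -> Prop) :
    Q 0 -> (forall c f g, Q f -> Q g -> Q (c *: f + g)) ->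
    (forall m, m \in mons d -> Q 'X_[mon m]) ->
  forall f, f \is d.-homog -> Q f.
Proof.
move=> Q0 Qlin Qmon f /dhomogP hf; rewrite [f]mpolyE big_seq.
elim/big_rec: _ => // n g nf Qg; apply: Qlin => //.
by have [m /Qmon ? ->] := mem_mons (hf n nf).
Qed.

Lemma meval_homogZ d f c v : f \is d.-homog ->
  f.@[(c *: v) ord0] = c ^+ d * f.@[v ord0].
Proof.
move=> /dhomogP hf; rewrite [f]mpolyE !raddf_sum mulr_sumr !big_seq.
apply: eq_bigr => m /hf /= <-; rewrite mdegE.
rewrite !mevalZ mulrCA; congr (_ * _); rewrite !mevalX -prodrXr -big_split.
by apply: eq_bigr => k _; rewrite mxE exprMn.
Qed.

(** If f vanishes at the points, the second sum drops out and a multiple of f is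
a combination of the polynomials of bs. *)
Lemma interpolation pts d D ls bs ss f :
    interpolation_certificate pts d D ls bs ss -> f \is d.-homog ->
  zr D *: f = \sum_(lb <- zip ls bs) coef_form lb.1 f *: poly_of lb.2 +
              \sum_(vs <- zip pts ss) f.@[vec vs.1 ord0] *: poly_of vs.2.
Proof.
move=> /allP cert; move: f.
apply: homog_ind => [|c f g IHf IHg|m /cert/znull_poly_of].
- rewrite scaler0 !big1 ?addr0 // => vs _; by rewrite ?linear0 ?meval0 scale0r.
- rewrite scalerDr scalerA mulrC -scalerA IHf IHg scalerDr !scaler_sumr.
  rewrite addrACA -!big_split; congr (_ + _); apply: eq_bigr => vs _ /=.
    by rewrite linearP scalerDl scalerA.
  by rewrite mevalD mevalZ scalerDl scalerA.
- rewrite poly_of_cons poly_of_cat !poly_of_flatten !big_map => /eqP.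
  rewrite addr_eq0 => /eqP ->; rewrite opprD -!sumrN.
  congr (_ + _); apply: eq_bigr => vs _ /=.
    rewrite poly_of_scale zrN scaleNr opprK; congr (_ *: _).
    by rewrite coef_form_mon.
  by rewrite poly_of_scale zrN scaleNr opprK meval_mon.
Qed.

Lemma evaluation pts t d q ws f :
    evaluation_certificate pts t d q ws -> f \is d.-homog ->
  coef_form t (poly_of q * f) =
    \sum_(vw <- zip pts ws) zr vw.2 * f.@[vec vw.1 ord0].
Proof.
move=> /allP cert; move: f.
apply: homog_ind => [|c f g IHf IHg|m /cert/Z.eqb_spec e].
- by rewrite mulr0 linear0 big1 // => vw _; rewrite meval0 mulr0.
- rewrite mulrDr -scalerAr [LHS]linearP /= IHf IHg mulr_sumr -big_split.
  by apply: eq_bigr => vw _; rewrite /= mevalD mevalZ mulrDr mulrCA.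
- rewrite -poly_of_mon -poly_of_mul coef_form_poly_of e zr_zsum big_map.
  by apply: eq_bigr => vw _; rewrite poly_of_mon meval_mon zrM.
Qed.

(** * The configuration *)

(** The lines are indexed by the integers modulo 12: the i-th, j-th and k-th are
concurrent exactly when i + j + k = 0 modulo 12.  Dually they are twelve points
of a cubic curve with the collinearities of the cyclic group of order 12. *)
Definition lines : seq (seq Z) := [::
  [:: 0; 1; 1];
  [:: 1; 1; 2];
  [:: 3; 1; 5];
  [:: 1; 0; 2];
  [:: 0; 0; 1];
  [:: 1; 0; 0];
  [:: 3; 1; 2];
  [:: 1; 1; 1];
  [:: 0; 1; 0];
  [:: 1; -1; 1];
  [:: 3; -2; 2];
  [:: 1; -1; 0]]%BZ.

(** The 19 triple points, in the lexicographic order of the triples i < j < k of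
lines through them. *)
Definition points : seq (seq Z) := [::
  [:: -1; -1; 1];
  [:: -4; -3; 3];
  [:: -2; -1; 1];
  [:: 1; 0; 0];
  [:: 0; -1; 1];
  [:: -3; -1; 2];
  [:: -2; 0; 1];
  [:: -1; 1; 0];
  [:: 0; -2; 1];
  [:: -2; 1; 1];
  [:: -1; 3; 0];
  [:: 0; 1; 0];
  [:: -2; -2; 1];
  [:: 1; 1; 0];
  [:: 0; 0; 1];
  [:: 0; 1; 1];
  [:: -1; -1; 2];
  [:: -2; 0; 3];
  [:: -1; 0; 1]]%BZ.

(** A basis of the quintics through the 19 points. *)
Definition quintic_rows : seq (seq Z) := [::
  [:: 0; 3; 0; 1; 14; 0; -3; -6; 15; 0; -1; -8; -15; 0; 0; 0; 0; 0; 0; 0; 0];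
  [:: 0; 0; 3; 0; -2; 11; 0; 3; -3; 12; 0; 0; 6; 2; 4; 0; 0; 0; 0; 0; 0];
  [:: 0; 0; 0; 0; 0; 0; 0; -3; -3; 0; 0; 0; -6; -6; 0; 0; 1; 2; -1; -2;
    0]]%BZ.

(** The forms that are singular at all the points have, in degree 12, the
elements of I^2 as a hyperplane; this linear form has that hyperplane as its
kernel among them.  Up to a factor, this determines it modulo the combinations
of the values and first derivatives at the 19 points; the freedom is used to
make it vanish on all monomials not divisible by x^5, so that it reads the
Taylor expansion at the single point (1 : 0 : 0). *)
Definition obstruction_row : seq Z :=
  [:: 0; 0; 0; 1654400; 140944; 19200; 558408; -672576; -27552; -1920; 554400;
    -408960; 259488; 3168; 0; 0; -186408; 135432; -87264; 0; 0; 0; -59616;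
    47952; -35640; 23328; 0; 0; 0; -13608; 9720; -7776; 5832; -3888; 0; 0; 0;
    0; 0; 0; 0; 0; 0; 0; 0; 0; 0; 0; 0; 0; 0; 0; 0; 0; 0; 0; 0; 0; 0; 0; 0; 0;
    0; 0; 0; 0; 0; 0; 0; 0; 0; 0; 0; 0; 0; 0; 0; 0; 0; 0; 0; 0; 0; 0; 0; 0; 0;
    0; 0; 0; 0]%BZ.

(** Multiplication by a basis quintic followed by the linear form above is, in
degree 7, a combination of the evaluations at the 19 points: the i-th row
lists its coefficients for the i-th quintic. *)
Definition weight_rows : seq (seq Z) := [::
  [:: 21384; -12; -3402; 4106928; 8262; 162; -6561; 382968; 324; 162; -1003;
    2220048; -324; -409455; 4374; -162; -162; -15; 34992];
  [:: -21384; 15; -972; 339856; -10449; -324; 10449; 13122; -162; 162; -21;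
    34992; 162; -2187; 972; -162; 324; -15; 21384];
  [:: -17496; 9; -4374; -3888; 2187; 0; -2187; -4374; 0; 0; 9; -17496; 0;
    2187; 4374; 0; 0; -9; 17496]]%BZ.

(** The data of the interpolation identities in degrees 4, 5 and 6, with a
common denominator 24, 48 and 216 respectively.  They come from the inversion
of a square submatrix of the matrix of values of the monomials at the points,
which has rank 15, 18 and 19: this is why four points in degree 4, and one in
degree 5, have a zero row. *)
Definition remainder_rows4 : seq (seq Z) := [::
  [:: 0; 0; 0; 0; 24; 0; 0; 0; 48; 0; 0; 0; 0; 0; 0];
  [:: 0; 0; 0; 0; 0; 0; 0; 0; 0; 0; 0; 0; 0; 0; 0];
  [:: 0; 0; 0; 0; 0; 0; 0; 0; 0; 0; 0; 0; 0; 0; 0];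
  [:: 24; 8; 88; -24; -16; 96; -8; -56; -48; 32; 0; 0; 0; 0; 0];
  [:: 0; 0; 0; 0; -24; 0; 0; 0; -48; 0; 0; 12; 12; -24; 0];
  [:: 0; 0; 0; 0; 0; 0; 0; 0; 0; 0; 0; 0; 0; 0; 0];
  [:: 0; 0; -9; 0; 0; -15; 0; 6; 6; -6; 0; 0; 0; 0; 0];
  [:: 0; -18; 0; 12; -30; 0; 6; 30; 0; 0; 0; 0; 0; 0; 0];
  [:: 0; 0; 0; 0; 4; 0; 0; 2; 6; 0; 0; -4; 0; 4; 0];
  [:: 0; 0; 0; 0; 4; 0; 0; -4; 0; 0; 0; 0; 0; 0; 0];
  [:: 0; 1; 0; 0; 1; 0; -1; -1; 0; 0; 0; 0; 0; 0; 0];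
  [:: 0; -72; 0; -24; -96; 0; 72; 24; -48; 0; 24; 48; -24; -48; 0];
  [:: 0; 0; 0; 0; -4; 0; 0; -2; -6; 0; 0; 0; 0; 0; 0];
  [:: 0; 9; 0; 12; 45; 0; 3; 27; 48; 0; 0; 0; 0; 0; 0];
  [:: 0; 0; 18; 0; 24; 66; 0; -6; 42; 72; 0; -12; -24; 12; 24];
  [:: 0; 0; 0; 0; -4; 0; 0; 4; 0; 0; 0; 4; 12; 8; 0];
  [:: 0; 0; 0; 0; 0; 0; 0; 0; 0; 0; 0; 0; 0; 0; 0];
  [:: 0; 0; -1; 0; 0; -3; 0; 0; 0; -2; 0; 0; 0; 0; 0];
  [:: 0; 0; 72; 0; -24; 192; 0; 0; -48; 96; 0; 0; 0; 0; 0]]%BZ.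

Definition coord_rows5 : seq (seq Z) := [::
  [:: 0; 0; 0; 0; 0; 0; 0; 0; 0; 0; -48; 0; 0; 0; 0; 0; 0; 0; 0; 0; 0];
  [:: 0; 0; 0; 0; 0; 0; 0; 0; 0; 0; 0; 0; 0; 0; 12; 0; 0; 0; 0; 0; 0];
  [:: 0; 0; 0; 0; 0; 0; 0; 0; 0; 0; 0; 0; 0; 0; 0; 0; 48; 0; 0; 0; 0]]%BZ.

Definition remainder_rows5 : seq (seq Z) := [::
  [:: 0; 0; 0; 0; 0; 0; 0; -96; -48; 0; 0; 0; -192; -96; 0; 0; 0; 0; 0; 0; 0];
  [:: 0; 0; 0; 0; 0; 0; 0; 0; 0; 0; 0; 0; 0; 0; 0; 0; 0; 0; 0; 0; 0];
  [:: 0; 0; 0; 0; 36; 0; 0; -24; 60; 0; 0; -12; -60; 0; 0; 0; 0; 0; 0; 0; 0];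
  [:: 48; 16; 176; -48; 96; 192; -16; -240; 96; 64; 0; -32; -288; -64; 0; 0;
    0; 0; 0; 0; 0];
  [:: 0; 0; 0; 0; -36; 0; 0; -24; -156; 0; 0; 12; -36; -192; 0; 0; 0; 24; 24;
    -48; 0];
  [:: 0; 0; 0; 0; -4; 0; 0; 4; -8; 0; 0; 0; 8; 0; 0; 0; 0; 0; 0; 0; 0];
  [:: 0; 0; 9; 0; -6; 15; 0; -15; -9; 6; 0; 12; -6; -6; 0; 0; 0; 0; 0; 0; 0];
  [:: 0; 36; 0; -24; 132; 0; -12; -108; 120; 0; 0; -24; -120; 0; 0; 0; 0; 0;
    0; 0; 0];
  [:: 0; 0; 0; 0; 4; 0; 0; 8; 20; 0; 0; -4; 16; 28; 0; 0; 0; -8; 0; 8; 0];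
  [:: 0; 0; 0; 0; -4; 0; 0; 8; -4; 0; 0; -4; 4; 0; 0; 0; 0; 0; 0; 0; 0];
  [:: 0; -2; 0; 0; -8; 0; 2; 4; -8; 0; 0; 4; 8; 0; 0; 0; 0; 0; 0; 0; 0];
  [:: 0; 432; 0; 0; 1728; 0; -480; -576; 2064; 0; 0; -960; -1152; 672; 0; 48;
    0; -240; 0; 192; 0];
  [:: 0; 0; 0; 0; -4; 0; 0; 8; -4; 0; 0; 4; 16; 4; 0; 0; 0; 0; 0; 0; 0];
  [:: 0; 18; 0; 24; 84; 0; 6; 72; 120; 0; 0; 12; 48; 48; 0; 0; 0; 0; 0; 0; 0];
  [:: 0; 0; -108; 0; 108; -360; 0; -132; 216; -300; 0; -12; -288; 12; 0; 0; 0;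
    -24; -48; 24; 48];
  [:: 0; 0; 0; 0; 4; 0; 0; 8; 20; 0; 0; 4; 28; 32; 0; 0; 0; 8; 24; 16; 0];
  [:: 0; 0; 0; 0; 4; 0; 0; 4; 16; 0; 0; 0; 8; 16; 0; 0; 0; 0; 0; 0; 0];
  [:: 0; 0; 1; 0; -2; 3; 0; 1; -5; 2; 0; 0; 2; -2; 0; 0; 0; 0; 0; 0; 0];
  [:: 0; 0; -144; 0; 384; -384; 0; -240; 864; -192; 0; 0; -480; 192; 0; 0; 0;
    0; 0; 0; 0]]%BZ.

Definition coord_rows6 : seq (seq Z) := [::
  [:: 0; 72; 0; 0; 0; 0; 0; 0; 0; 0; 0; 0; 0; 0; 0; 0; 0; 0; 0; 0; 0; 0; 0; 0;
    0; 0; 0; 0];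
  [:: 0; -24; 0; 0; 0; 0; 0; 0; 0; 0; -72; 0; 0; 0; 0; 0; 0; 0; 0; 0; 0; 0; 0;
    0; 0; 0; 0; 0];
  [:: 0; -240; 24; 0; 36; 0; 0; 0; 0; 0; 72; -36; 0; 0; 0; 0; 0; 0; 0; 0; 0;
    0; -108; 0; 0; 0; 0; 0];
  [:: 0; 0; 72; 0; 0; 0; 0; 0; 0; 0; 0; 0; 0; 0; 0; 0; 0; 0; 0; 0; 0; 0; 0; 0;
    0; 0; 0; 0];
  [:: 0; -96; 24; 0; 36; 0; 0; 0; 0; 0; -72; 36; 0; 0; 0; 0; 0; 0; 0; 0; 0; 0;
    108; 0; 0; 0; 0; 0];
  [:: 0; 0; -264; 0; 0; 72; 0; 0; 0; 0; 0; 0; 0; 0; 0; 0; 0; 0; 0; 0; 0; 0; 0;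
    0; 0; 0; 0; 0];
  [:: 0; -432; 24; 0; 36; 0; 0; 0; 0; 0; -504; -36; 0; 0; 0; 0; 216; 0; 0; 0;
    0; 0; -108; 0; 0; 0; 0; 0];
  [:: 0; 0; 0; 0; 0; 0; 0; 0; 0; 0; 0; 0; 0; 0; 0; 0; 0; 0; 0; 0; 0; 0; 216;
    0; 0; 0; 0; 0];
  [:: 0; 0; 0; 0; 0; 0; 0; 0; 0; 0; 0; 0; 0; 0; 0; 0; 0; 0; 0; 0; 0; 0; -432;
    216; 0; 0; 0; 0]]%BZ.

Definition remainder_rows6 : seq (seq Z) := [::
  [:: 0; 0; 0; 0; 0; 0; 0; -1296; -648; 0; 0; 0; -4320; -2160; 0; 0; 0; 0;
    -3456; -1728; 0; 0; 0; 0; 0; 0; 0; 0];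
  [:: 0; 0; 0; 0; 0; 0; 0; 2; 1; 0; 0; 0; 6; 3; 0; 0; 0; 0; 4; 2; 0; 0; 0; 0;
    0; 0; 0; 0];
  [:: 0; 0; 0; 0; 0; 0; 0; 0; 162; 0; 0; 0; -108; 270; 0; 0; 0; -54; -270; 0;
    0; 0; 0; 0; 0; 0; 0; 0];
  [:: 216; 0; 0; -216; 0; 0; 8; -1776; -3168; 4600; 0; 0; -336; -6000; 7104;
    -8; 0; 8; 4704; 640; 2720; 0; 0; 0; 0; 0; 0; 0];
  [:: 0; 0; 0; 0; 0; 0; 0; -162; -243; 0; 0; 0; -594; -945; 0; 0; 0; 54; -486;
    -1026; 0; 0; 0; 0; 108; 108; -216; 0];
  [:: 0; 0; 0; 0; 0; 0; 0; -18; -18; 0; 0; 0; -45; -45; 0; 0; 0; 0; -18; -18;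
    0; 0; 0; 0; 0; 0; 0; 0];
  [:: 0; 0; 0; 0; 0; 0; 0; 162; 81; -81; 0; 0; 378; 243; -135; 0; 0; 54; 216;
    108; -54; 0; 0; 0; 0; 0; 0; 0];
  [:: 0; 0; 0; 108; 0; 0; -126; 450; 108; 0; 0; 0; 1053; 405; 0; 18; 0; 414;
    1170; 450; 0; 0; 0; 0; 0; 0; 0; 0];
  [:: 0; 0; 0; 0; 0; 0; 0; 36; 36; 0; 0; 0; 144; 144; 0; 0; 0; -18; 144; 162;
    0; 0; 0; 0; -36; 0; 36; 0];
  [:: 0; 0; 0; 0; 0; 0; 0; -36; -36; 0; 0; 0; -72; -72; 0; 0; 0; -18; -54;
    -36; 0; 0; 0; 0; 0; 0; 0; 0];
  [:: 0; 0; 0; 0; 0; 0; 1; -6; -7; 0; 0; 0; -15; -15; 0; -1; 0; 1; -6; -6; 0;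
    0; 0; 0; 0; 0; 0; 0];
  [:: 0; 0; 0; -216; 0; 0; -720; 3312; 4968; 0; 0; 0; 5184; 6480; 0; 720; 0;
    -720; -4608; -4032; 0; 216; 0; 0; 2160; -216; -2160; 0];
  [:: 0; 0; 0; 0; 0; 0; 0; -36; -36; 0; 0; 0; -72; -72; 0; 0; 0; 18; 0; -18;
    0; 0; 0; 0; 0; 0; 0; 0];
  [:: 0; 0; 0; 108; 0; 0; 117; 612; 27; 0; 0; 0; 648; 0; 0; -9; 0; -423; -288;
    -144; 0; 0; 0; 0; 0; 0; 0; 0];
  [:: 0; 0; 0; 0; 0; 0; 0; 0; 162; 162; 0; 0; -108; 486; 594; 0; 0; -54; -324;
    378; 648; 0; 0; 0; -108; -216; 108; 216];
  [:: 0; 0; 0; 0; 0; 0; 0; 36; 36; 0; 0; 0; 144; 144; 0; 0; 0; 18; 198; 180;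
    0; 0; 0; 0; 36; 108; 72; 0];
  [:: 0; 0; 0; 0; 0; 0; 0; 18; 18; 0; 0; 0; 63; 63; 0; 0; 0; 0; 54; 54; 0; 0;
    0; 0; 0; 0; 0; 0];
  [:: 0; 0; 0; 0; 0; 0; 0; -2; -3; -1; 0; 0; -6; -9; -3; 0; 0; 0; -4; -6; -2;
    0; 0; 0; 0; 0; 0; 0];
  [:: 0; 0; 0; 0; 0; 0; 0; 1296; 1944; 648; 0; 0; 3456; 5184; 1728; 0; 0; 0;
    1728; 2592; 864; 0; 0; 0; 0; 0; 0; 0]]%BZ.

Definition quintics : seq zpoly := [seq form 5 r | r <- quintic_rows].
Definition sextics : seq zpoly :=
  [seq zmul q [:: (1%BZ, u)] | q <- quintics, u <- mons 1].
Definition obstruction : zpoly := form 12 obstruction_row.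
Definition arrangement : zpoly :=
  foldr zmul [:: (1%BZ, (0, 0, 0)%N)] [seq form 1 l | l <- lines].

(** * Forms through the points *)

(** Vanishing is asked on all nonzero multiples of a vector of coordinates, so
that it passes to homogeneous components. *)
Definition vanishing f : Prop :=
  forall P, P \in points -> forall c, c != 0 -> f.@[(c *: vec P) ord0] = 0.

(** On the line spanned by the vector of P, a polynomial f restricts to a
polynomial in the scalar, whose coefficients are the values at P of the
homogeneous components of f; it has infinitely many zeros. *)
Lemma vanishing_pihomog f d : vanishing f ->
  forall P, P \in points -> (pihomog mdeg d f).@[vec P ord0] = 0.
Proof.
move=> vf P P_in; have fE := pihomog_partitionE (leqnn (msize f)).
pose c e := (pihomog mdeg e f).@[vec P ord0].
pose r := \poly_(e < msize f) c e.
have root_r n : root r n.+1%:R.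
  apply/eqP; rewrite horner_poly.
  transitivity f.@[(n.+1%:R *: vec P) ord0]; last by rewrite vf // pnatr_eq0.
  rewrite [X in _ = X.@[_]]fE raddf_sum; apply: eq_bigr => e _ /=.
  by rewrite (meval_homogZ _ _ (pihomogP _ _ _)) mulrC.
have r0 : r = 0.
  apply: (@roots_geq_poly_eq0 _ _ [seq n.+1%:R | n <- iota 0 (size r)]).
  - by apply/allP => _ /mapP[n _ ->].
  - rewrite map_inj_uniq ?iota_uniq // => i j /eqP.
    by rewrite eqr_nat => /eqP[].
  - by rewrite size_map size_iota.
have [lt|le] := ltnP d (msize f).
  by have := congr1 (fun q : {poly K} => q`_d) r0; rewrite coef_poly lt coef0.
rewrite pihomogE big_seq_cond big1 ?meval0 // => m /andP[/msize_mdeg_lt].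
by move=> lt /eqP e; rewrite e ltnNge le in lt.
Qed.

Lemma quartic_certificate :
  interpolation_certificate points 4 24 [::] [::]
    [seq form 4 r | r <- remainder_rows4].
Proof. by vm_compute. Qed.

Lemma quintic_certificate :
  interpolation_certificate points 5 48
    [seq form 5 r | r <- coord_rows5] quintics
    [seq form 5 r | r <- remainder_rows5].
Proof. by vm_compute. Qed.

Lemma sextic_certificate :
  interpolation_certificate points 6 216
    [seq form 6 r | r <- coord_rows6] sextics
    [seq form 6 r | r <- remainder_rows6].
Proof. by vm_compute. Qed.

Lemma weights_certificate :
  all (fun qw => evaluation_certificate points obstruction 7 qw.1 qw.2)
    (zip quintics weight_rows).
Proof. by vm_compute. Qed.

Lemma vanishing_interpolation d D ls bs ss f :
    interpolation_certificate points d D ls bs ss -> f \is d.-homog ->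
    (forall P, P \in points -> f.@[vec P ord0] = 0) ->
  zr D *: f = \sum_(lb <- zip ls bs) coef_form lb.1 f *: poly_of lb.2.
Proof.
move=> cert hf vf; rewrite (interpolation cert hf) [X in _ + X]big_seq.
rewrite [X in _ + X]big1 ?addr0 // => -[P s] /mem_zip/andP[P_in _].
by rewrite vf ?scale0r.
Qed.

(** In degree less than 4, multiplication by a power of z leads back to
quartics. *)
Lemma no_quartic d f : (d <= 4)%N -> f \is d.-homog ->
  (forall P, P \in points -> f.@[vec P ord0] = 0) -> f = 0.
Proof.
move=> led hf vf; pose z : {mpoly K[3]} := 'X_ord_max ^+ (4 - d).
have hzf : z * f \is 4.-homog.
  rewrite -(subnK led) -[X in (X + _)%N]mul1n dhomogM ?dhomogMn //.
  by rewrite dhomogX; apply/eqP/mdeg1.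
have /eqP : z * f = 0.
  apply: (scalerI (_ : zr 24 != 0)); first by rewrite zr_eq0.
  rewrite scaler0 (vanishing_interpolation quartic_certificate hzf) ?big_nil //.
  by move=> P P_in; rewrite mevalM vf // mulr0.
rewrite mulf_eq0 expf_eq0 -[X in _ && X]msupp_eq0 msuppX andbF.
by move/eqP.
Qed.

Lemma obstruction_quintic q g : q \in quintics -> g \is 7.-homog ->
  (forall P, P \in points -> g.@[vec P ord0] = 0) ->
  coef_form obstruction (poly_of q * g) = 0.
Proof.
move=> q_in hg vg.
have [ws /(allP weights_certificate) cert] :
    exists ws, (q, ws) \in zip quintics weight_rows.
  exists (nth [::] weight_rows (index q quintics)).
  rewrite -[X in (X, _)](nth_index [::] q_in) -nth_zip //.
  by rewrite mem_nth // size_zip minnn index_mem.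
rewrite (evaluation cert hg) big_seq big1 // => -[P c] /mem_zip/andP[P_in _].
by rewrite vg ?mulr0.
Qed.

(** The three cases for the smaller degree i: if i <= 4 then f = 0; if i = 5 it
is a combination of the three quintics; if i = 6 it is a combination of products
of a quintic and a coordinate, and the coordinate is moved to g, which has
degree 6, to make a form of degree 7. *)
Lemma obstruction_homog_mul i j f g : (i + j = 12)%N -> (i <= j)%N ->
    f \is i.-homog -> g \is j.-homog ->
    (forall P, P \in points -> f.@[vec P ord0] = 0) ->
    (forall P, P \in points -> g.@[vec P ord0] = 0) ->
  coef_form obstruction (f * g) = 0.
Proof.
move=> ij12 leij hf hg vf vg.
have [le4|gt4] := leqP i 4.
  by rewrite (no_quartic le4 hf vf) mul0r linear0.
have [D [ls [bs [nzD fE bs0]]]] : exists D ls bs,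
    [/\ zr D != 0,
        zr D *: f = \sum_(lb <- zip ls bs) coef_form lb.1 f *: poly_of lb.2
      & forall b, b \in bs -> coef_form obstruction (poly_of b * g) = 0].
  have /orP[/eqP i5|/eqP i6] : (i == 5) || (i == 6) by lia.
    rewrite i5 in hf; have {ij12}j7 : j = 7 by lia.
    rewrite j7 in hg.
    exists 48%BZ, [seq form 5 r | r <- coord_rows5], quintics; split.
    - by rewrite zr_eq0.
    - exact: vanishing_interpolation quintic_certificate hf vf.
    - by move=> q q_in; apply: obstruction_quintic.
  rewrite i6 in hf; have {ij12}j6 : j = 6 by lia.
  rewrite j6 in hg.
  exists 216%BZ, [seq form 6 r | r <- coord_rows6], sextics; split.
  - by rewrite zr_eq0.
  - exact: vanishing_interpolation sextic_certificate hf vf.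
  - move=> _ /allpairsP[[q v] [/= q_in v_in ->]].
    rewrite poly_of_mul poly_of_mon -mulrA; apply: obstruction_quintic => //.
      apply: (@dhomogM _ _ _ 1%N _ 6) => //; rewrite dhomogX.
      exact/eqP/mdeg_mons.
    by move=> P P_in; rewrite mevalM vg ?mulr0.
apply: (mulfI nzD); rewrite mulr0 -linearZ scalerAl fE mulr_suml raddf_sum.
rewrite big_seq big1 // => -[l b] /mem_zip/andP[_ b_in].
by rewrite -scalerAl /= linearZ /= bs0 ?mulr0.
Qed.

Lemma obstruction_homog_ne f d : f \is d.-homog -> d != 12 ->
  coef_form obstruction f = 0.
Proof.
move=> hf ned; rewrite /coef_form big_seq big1 // => a a_in.
have dega : mdeg (mon a.2) = 12.
  by rewrite mdeg_mon; apply/eqP; move: a a_in; apply/allP.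
by rewrite (dhomog_nemf_coeff hf) ?mulr0 //= dega eq_sym.
Qed.

Lemma obstruction_vanishing_mul f g : vanishing f -> vanishing g ->
  coef_form obstruction (f * g) = 0.
Proof.
move=> vf vg.
rewrite [f](pihomog_partitionE (leqnn (msize f))).
rewrite [g](pihomog_partitionE (leqnn (msize g))).
rewrite mulr_suml raddf_sum big1 // => i _.
rewrite mulr_sumr raddf_sum big1 // => j _ /=.
have [ij12|ne] := eqVneq (i + j)%N 12; last first.
  by apply: obstruction_homog_ne ne; apply: dhomogM; apply: pihomogP.
have [leij|/ltnW leji] := leqP i j.
  apply: (obstruction_homog_mul ij12) => //; try exact: pihomogP;
    exact: vanishing_pihomog.
rewrite addnC in ij12; rewrite mulrC.
apply: (obstruction_homog_mul ij12) => //; try exact: pihomogP;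
  exact: vanishing_pihomog.
Qed.

(** * Order of vanishing of products *)

Lemma vanishes_to_orderS m f (Q : proj_plane K) :
  vanishes_at f Q -> (forall i, vanishes_to_order m f^`M(i) Q) ->
  vanishes_to_order m.+1 f Q.
Proof.
move=> f0 df k ltk; have [->|nek] := eqVneq k 0%MM.
  by rewrite mderivm0m.
have [i ki] : exists i, k i != 0%N.
  apply/existsP; apply: contraNT nek; rewrite negb_exists => /forallP k0.
  by apply/eqP/mnmP => i; rewrite mnm0E; apply/eqP; rewrite -[_ == _]negbK.
have kE : (U_(i) + (k - U_(i)))%MM = k by rewrite addmC submK // lep1mP.
rewrite -kE mderivmDm mderivmU1m; apply: df.
by move: ltk; rewrite -{1}kE mdegD mdeg1.
Qed.

Lemma vanishes_to_order_deriv m f (Q : proj_plane K) i :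
  vanishes_to_order m.+1 f Q -> vanishes_to_order m f^`M(i) Q.
Proof.
move=> vf k ltk; rewrite -mderivmU1m -mderivmDm; apply: vf.
by rewrite mdegD mdeg1 add1n.
Qed.

Lemma vanishes_to_order_at m f (Q : proj_plane K) :
  vanishes_to_order m.+1 f Q -> vanishes_at f Q.
Proof. by move=> vf; rewrite -[f]mderivm0m; apply: vf; rewrite mdeg0. Qed.

Lemma vanishes_to_orderD m f g (Q : proj_plane K) :
  vanishes_to_order m f Q -> vanishes_to_order m g Q ->
  vanishes_to_order m (f + g) Q.
Proof.
move=> vf vg k ltk v vQ.
by rewrite mderivmD mevalD (vf k ltk v vQ) (vg k ltk v vQ) addr0.
Qed.

Lemma vanishes_to_order_leq m n f (Q : proj_plane K) : (m <= n)%N ->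
  vanishes_to_order n f Q -> vanishes_to_order m f Q.
Proof. by move=> lemn vf k ltk; apply: vf; apply: leq_trans lemn. Qed.

Lemma vanishes_to_order_mull m f g (Q : proj_plane K) :
  vanishes_to_order m f Q -> vanishes_to_order m (g * f) Q.
Proof.
elim: m f g => [|m IH] f g vf; first by move=> k; rewrite ltn0.
apply: vanishes_to_orderS => [v vQ|i].
  by rewrite mevalM (vanishes_to_order_at vf) ?mulr0.
rewrite mderivM; apply: vanishes_to_orderD; apply: IH.
  exact: vanishes_to_order_leq vf.
exact: vanishes_to_order_deriv.
Qed.

Lemma vanishes_to_order_mulS m f g (Q : proj_plane K) :
  vanishes_at g Q -> vanishes_to_order m f Q ->
  vanishes_to_order m.+1 (g * f) Q.
Proof.
elim: m f => [|m IH] f vg vf.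
  apply: vanishes_to_orderS => [v vQ|i k]; last by rewrite ltn0.
  by rewrite mevalM vg ?mul0r.
apply: vanishes_to_orderS => [v vQ|i]; first by rewrite mevalM vg ?mul0r.
rewrite mderivM; apply: vanishes_to_orderD.
  exact: vanishes_to_order_mull.
by apply: IH => //; apply: vanishes_to_order_deriv.
Qed.

Lemma vanishes_to_order_prod (I : eqType) (s : seq I) (a : pred I)
    (G : I -> {mpoly K[3]}) (Q : proj_plane K) :
  (forall i, i \in s -> a i -> vanishes_at (G i) Q) ->
  vanishes_to_order (count a s) (\prod_(i <- s) G i) Q.
Proof.
elim: s => [|i s IH] vG; first by move=> k.
rewrite big_cons /=; have {IH} := IH _.
case: (boolP (a i)) => ai IH; [apply: vanishes_to_order_mulS|].
- by apply: vG => //; rewrite mem_head.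
- by apply: IH => j js; apply: vG; rewrite inE js orbT.
- apply: vanishes_to_order_mull.
  by apply: IH => j js; apply: vG; rewrite inE js orbT.
Qed.

(** * Shears *)

Definition shear (t : K) : {mpoly K[3]} -> {mpoly K[3]} :=
  comp_mpoly [tuple 'X_0 + t *: 'X_ord_max; 'X_1; 'X_ord_max].

HB.instance Definition _ (t : K) := GRing.LRMorphism.copy (shear t) (shear t).

Definition shear_vec (t : K) (v : 'rV[K]_3) : 'rV[K]_3 :=
  \row_i (v 0 i + (if i == 0 then t * v 0 ord_max else 0)).

Lemma meval_shear (t : K) f v : (shear t f).@[v ord0] = f.@[shear_vec t v ord0].
Proof.
rewrite /shear comp_mpoly_meval; apply: meval_eq => -[[|[|[|//]]] p];
  rewrite mxE (tnth_nth 0) /=.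
- by rewrite mevalD mevalZ !mevalXU; congr (v _ _ + _); apply: val_inj.
- by rewrite mevalXU addr0; congr (v _ _); apply: val_inj.
- by rewrite mevalXU addr0; congr (v _ _); apply: val_inj.
Qed.

Lemma shear_vecD (s t : K) v :
  shear_vec s (shear_vec t v) = shear_vec (s + t) v.
Proof. by apply/rowP => i; rewrite !mxE /=; case: eqP => _; ring. Qed.

Lemma shear_vec0 v : shear_vec 0 v = v.
Proof. by apply/rowP => i; rewrite !mxE mul0r if_same addr0. Qed.

Lemma shear_vecZ (t : K) c v : shear_vec t (c *: v) = c *: shear_vec t v.
Proof. by apply/rowP => i; rewrite !mxE; case: eqP => _; ring. Qed.

Lemma shearM (t : K) : {morph shear t : f g / f * g}.
Proof. exact: rmorphM. Qed.

Lemma shearK (t : K) : cancel (shear (- t)) (shear t).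
Proof.
move=> f; rewrite {1}[f]mpolyE [RHS]mpolyE.
rewrite [shear (- t) _]raddf_sum [LHS]raddf_sum.
apply: eq_bigr => m _ /=; rewrite !linearZ; congr (_ *: _).
rewrite mpolyXE_id !rmorph_prod; apply: eq_bigr => i _ /=.
rewrite !rmorphXn; congr (_ ^+ _) => /=; rewrite [shear (- t) _]comp_mpolyXU.
case: i => -[|[|[|//]]] p /=.
- rewrite /shear comp_mpolyD comp_mpolyZ !comp_mpolyXU /= scaleNr addrK.
  by congr 'X_[U_(_)]; apply: val_inj.
- by rewrite /shear comp_mpolyXU /=; congr 'X_[U_(_)]; apply: val_inj.
- by rewrite /shear comp_mpolyXU /=; congr 'X_[U_(_)]; apply: val_inj.
Qed.

Lemma homog_shear (t : K) d f : f \is d.-homog -> shear t f \is d.-homog.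
Proof.
have hX i : ('X_i : {mpoly K[3]}) \is 1.-homog.
  by rewrite dhomogX; apply/eqP/mdeg1.
move: f; apply: homog_ind => [|c f g hf hg|m /mdeg_mons <-].
- by rewrite /shear comp_mpoly0 dhomog0.
- by rewrite /shear comp_mpolyD comp_mpolyZ rpredD ?rpredZ.
rewrite /shear comp_mpolyX mdegE; elim/big_ind2: _ => [|x n y m' hx hy|i _].
- exact: dhomog1.
- exact: dhomogM.
rewrite -[X in X.-homog]mul1n; apply: dhomogMn.
by case: i => -[|[|[|//]]] p; rewrite (tnth_nth 0) //= rpredD ?rpredZ.
Qed.

(** * The sheared configurations *)

Fact line_dim : \dim <[delta_mx ord0 ord0 : 'rV[K]_3]>%VS == 1%N.
Proof.
rewrite dim_vline eqb1; apply/eqP => /rowP/(_ ord0)/eqP.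
by rewrite !mxE eqxx oner_eq0.
Qed.

(** The line spanned by a nonzero vector; the value on the zero vector is
arbitrary. *)
Definition proj_point v : proj_plane K :=
  insubd (exist (fun U : {vspace 'rV[K]_3} => \dim U == 1%N) _ line_dim) <[v]>%VS.

Lemma hcoord_proj_point v w : v != 0 ->
  hcoord (proj_point v) w <-> exists2 c, c != 0 & w = c *: v.
Proof.
move=> nzv; rewrite /hcoord val_insubd dim_vline nzv eqxx; split.
  case=> nzw /vlineP[c wE]; exists c => //.
  by apply: contraNneq nzw => c0; rewrite wE c0 scale0r.
case=> c nzc ->; rewrite scaler_eq0 negb_or nzc nzv; split=> //.
by apply/vlineP; exists c.
Qed.

Lemma vec_neq0 P : P \in points -> vec P != 0.
Proof.
move=> P_in; apply/eqP => /rowP v0.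
have z i : (i < 3)%N -> Z.eqb P`_i 0.
  by move=> lti; have := v0 (Ordinal lti); rewrite !mxE -zr_eq0 => ->.
suff /negP : ~~ [&& Z.eqb P`_0 0, Z.eqb P`_1 0 & Z.eqb P`_2 0].
  by apply; rewrite !z.
by move: P P_in {v0 z}; apply/allP; vm_compute.
Qed.

Lemma shear_vec_neq0 (t : K) v : v != 0 -> shear_vec t v != 0.
Proof.
apply: contra_neq => /(congr1 (shear_vec (- t))).
rewrite shear_vecD addNr shear_vec0 => ->.
by apply/rowP => i; rewrite !mxE mulr0 if_same addr0.
Qed.

Definition sheared_points (t : K) : {fset proj_plane K} :=
  [fset proj_point (shear_vec t (vec P)) | P in points]%fset.

Lemma vanishes_at_sheared (t : K) f P : P \in points ->
  vanishes_at f (proj_point (shear_vec t (vec P))) <->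
  (forall c, c != 0 -> (shear t f).@[(c *: vec P) ord0] = 0).
Proof.
move=> P_in; have nz := shear_vec_neq0 t (vec_neq0 P_in).
split=> vf => [c nzc|v].
  rewrite meval_shear shear_vecZ; apply: vf.
  by apply/hcoord_proj_point => //; exists c.
case/(hcoord_proj_point _ nz) => c nzc ->.
by rewrite -shear_vecZ -meval_shear vf.
Qed.

Lemma point_ideal_vanishing (t : K) f :
  point_ideal (sheared_points t) f -> vanishing (shear t f).
Proof.
move=> If P P_in; apply/(vanishes_at_sheared t f P_in).
move: f If; apply: smallest_sub.
  split=> [v _|f g vf vg v vP|a f vf v vP]; first by rewrite meval0.
    by rewrite mevalD vf ?vg ?addr0.
  by rewrite mevalM vf ?mulr0.
by move=> f [_ vf]; apply: vf; apply/imfsetP; exists P.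
Qed.

(** The kernel of the linear form is not an ideal, so membership is shown in the
largest ideal contained in it. *)
Lemma obstruction_square_ideal (t : K) f :
  ideal_pow (point_ideal (sheared_points t)) 2 f ->
  coef_form obstruction (shear t f) = 0.
Proof.
suff: ideal_pow (point_ideal (sheared_points t)) 2 `<=`
      [set f | forall h, coef_form obstruction (shear t (h * f)) = 0].
  by move=> sub /sub/(_ 1); rewrite mul1r.
apply: smallest_sub.
  split=> [h|f0 g vf vg h|a f0 vf h]; first by rewrite mulr0 !raddf0.
    by rewrite mulrDr raddfD raddfD /= vf vg addr0.
  by rewrite mulrA vf.
move=> _ [u Iu ->] h; rewrite !big_ord_recl big_ord0 mulr1 mulrA shearM.
apply: obstruction_vanishing_mul; last exact/point_ideal_vanishing.
by move=> P P_in c nzc; rewrite shearM mevalM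
  (point_ideal_vanishing (Iu _)) ?mulr0.
Qed.

Definition line_form (l : seq Z) : {mpoly K[3]} := poly_of (form 1 l).

Lemma arrangementE : poly_of arrangement = \prod_(l <- lines) line_form l.
Proof.
rewrite /arrangement -(big_map (form 1) xpredT poly_of).
elim: (map _ _) => [|p ps IH]; last by rewrite big_cons /= poly_of_mul IH.
rewrite big_nil poly_of_mon (_ : mon _ = 0%MM) ?mpolyX0 //.
by apply/mnmP => -[[|[|[|//]]] p]; rewrite mnm0E.
Qed.

Definition on_line (P l : seq Z) : bool :=
  Z.eqb (zsum [seq Z.mul a.1 (zmon P a.2) | a <- form 1 l]) 0.

Lemma meval_poly_of p P :
  (poly_of p).@[vec P ord0] = zr (zsum [seq Z.mul a.1 (zmon P a.2) | a <- p]).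
Proof.
rewrite zr_zsum big_map /poly_of raddf_sum; apply: eq_bigr => a _ /=.
by rewrite mevalZ meval_mon zrM.
Qed.

Lemma homog_line_form l : line_form l \is 1.-homog.
Proof.
rewrite /line_form /poly_of big_seq rpred_sum // => a.
rewrite mem_filter => /andP[_ a_in]; rewrite rpredZ // dhomogX.
by apply/eqP/mdeg_mons; case: a a_in => c m /mem_zip/andP[].
Qed.

Lemma triple_points : all (fun P => 3 <= count (on_line P) lines)%N points.
Proof. by vm_compute. Qed.

Lemma sheared_arrangement_symbolic (t : K) :
  symbolic_pow (sheared_points t) 3 (shear (- t) (poly_of arrangement)).
Proof.
rewrite arrangementE rmorph_prod /=; apply: sub_gen_smallest; split.
  rewrite big_seq; elim/big_rec: _ => [|l f _ [d hf]].
    by exists 0%N; apply: dhomog1.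
  exists (1 + d)%N; apply: dhomogM => //.
  exact/homog_shear/homog_line_form.
move=> _ /imfsetP[P /= P_in ->].
apply: (@vanishes_to_order_leq _ (count (on_line P) lines)).
  exact: (allP triple_points).
apply: vanishes_to_order_prod => l _ /=; rewrite /on_line -zr_eq0 => /eqP Pl.
apply/vanishes_at_sheared => // c _; rewrite shearK.
by rewrite (meval_homogZ _ _ (homog_line_form l)) meval_poly_of Pl mulr0.
Qed.

Lemma not_contained (t : K) :
  ~ (symbolic_pow (sheared_points t) 3 `<=`
     ideal_pow (point_ideal (sheared_points t)) 2).
Proof.
move=> sub.
have /obstruction_square_ideal/eqP := sub _ (@sheared_arrangement_symbolic t).
rewrite shearK coef_form_poly_of zr_eq0; apply/negP.
by vm_compute.
Qed.

(** If the j-th and i-th sets are equal and i < j, the image of (0 : 0 : 1) by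
the shear j - i is a point of the configuration; but a point (a : 0 : c) of the
configuration has a c <= 0. *)
Lemma sheared_points_inj :
  injective (fun j : nat => sheared_points (j%:R : K)).
Proof.
have nz0 : [:: 0; 0; 1]%BZ \in points by [].
suff sub i j : (i <= j)%N ->
    sheared_points (j%:R : K) = sheared_points i%:R -> i = j.
  move=> i j e; have [/sub|/ltnW/sub] := leqP i j; first exact.
  by move/(_ e)/esym.
move=> leij e; apply/eqP; rewrite eqn_leq leij /= leqNgt; apply/negP => ltij.
have : proj_point (shear_vec j%:R (vec [:: 0; 0; 1]%BZ)) \in
    sheared_points (i%:R : K).
  by rewrite -e; apply/imfsetP; exists [:: 0; 0; 1]%BZ.
case/imfsetP=> P /= P_in PE.
have : hcoord (proj_point (shear_vec (j%:R : K) (vec [:: 0; 0; 1]%BZ)))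
    (shear_vec (i%:R : K) (vec P)).
  rewrite PE; apply/hcoord_proj_point; first exact/shear_vec_neq0/vec_neq0.
  by exists 1; rewrite ?oner_neq0 ?scale1r.
case/hcoord_proj_point; first exact/shear_vec_neq0/vec_neq0.
move=> c _ /rowP vE.
have := vE ord0; have := vE (inord 1); have := vE ord_max; rewrite !mxE /=.
rewrite inordK //= (_ : inord 1 == 0 = false); last first.
  by apply/eqP => /(congr1 val); rewrite /= inordK.
rewrite zr0 zr1 !addr0 add0r !mulr1 mulr0 => <- /eqP b0 /eqP.
(* In coordinates P = (a, b, c): b = 0 and a = c (j - i). *)
have zj : j%:R = i%:R + zr (Z.of_nat (j - i)).
  rewrite /zr (_ : int_of_Z _ = (j - i)%N) -?natrD ?subnKC //.
  by rewrite -[RHS]Z_of_intK.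
rewrite zj mulrDr addrC [zr _ * i%:R]mulrC (inj_eq (addrI _)) -subr_eq0.
rewrite -zrM -zrN -zrD zr_eq0 => /Z.eqb_spec aE.
rewrite zr_eq0 in b0.
have : Z.eqb P`_1 0 ==> Z.leb (Z.mul P`_0 P`_2) 0 &&
          ~~ (Z.eqb P`_0 0 && Z.eqb P`_2 0).
  by move: P P_in {PE vE b0 aE}; apply/allP; vm_compute.
rewrite b0 /=; move: ltij aE {vE}; move: P`_0 P`_2 => a d; nia.
Qed.

End Construction.

Theorem theorem3 (R : realType) :
  exists Z : nat -> {fset proj_plane R},
    injective Z /\
    forall j : nat,
      Z j != fset0 /\
      ~ (symbolic_pow (Z j) 3 `<=` ideal_pow (point_ideal (Z j)) 2).
Proof.
exists (fun j => sheared_points (j%:R : R)); split.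
  exact: sheared_points_inj.
move=> j; split; last exact: not_contained.
apply/fset0Pn; exists (proj_point (shear_vec j%:R (vec R [:: 0; 0; 1]%BZ))).
by apply/imfsetP; exists [:: 0; 0; 1]%BZ.
Qed.
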